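(* Let $m\ge 4$ be even, $n=2^m-1$, let $i_1\neq i_2$ in $\{0,1,2,3\}$, and let $\mathcal{C}=\mathcal{C}_{i_1,i_2}$ be the binary code with parity check matrix $H_m(\mathbf{v}_{i_1,i_2})$. \begin{itemize} \item If $\{i_1,i_2\}=\{0,1\}$ or $\{0,3\}$, then $\mathcal{C}$ is a non-antipodal completely transitive code with covering radius $\rho=3$ and intersection array $(n,(n-3)/2,1;\,1,(n-3)/2,n)$. \item If $\{i_1,i_2\}=\{1,2\}$ or $\{2,3\}$, then $\mathcal{C}$ is an antipodal completely transitive code with covering radius $\rho=3$ and intersection array $(n,(n+1)/2,1;\,1,(n+1)/2,n)$. \item If $\{i_1,i_2\}=\{0,2\}$, then $\mathcal{C}$ is the even-weight subcode of the Hamming code, i.e. a completely transitive $[n,n-m-1,4]$ code with covering radius $\rho=3$. \item If $\{i_1,i_2\}=\{1,3\}$, then $\mathcal{C}$ is the Hamming code $\mathcal{H}_m$. \end{itemize}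
   Context: $\mathbb{F}_2$ is the binary field. Let $m\ge 4$ be even and $n=2^m-1$. Let $\alpha$ be a primitive element of $GF(2^m)$ and let $H_m$ be the $m\times n$ binary matrix whose $i$-th column $\mathbf{h}_i$ ($i=0,\dots,n-1$) is the coordinate vector of $\alpha^i$ with respect to the basis $1,\alpha,\dots,\alpha^{m-1}$; thus the columns of $H_m$ are exactly the nonzero vectors of $\mathbb{F}_2^m$, and $H_m$ is a parity check matrix of the binary Hamming code $\mathcal{H}_m$ (an $[n,n-m,3]$ code). For distinct $i_1,i_2\in\{0,1,2,3\}$ let $\mathbf{v}_{i_1,i_2}=(v_0,\dots,v_{n-1})$ where $v_i=1$ if the Hamming weight $\mathrm{wt}(\mathbf{h}_i)\equiv i_1$ or $i_2 \pmod 4$, and $v_i=0$ otherwise. $H_m(\mathbf{v}_{i_1,i_2})$ is $H_m$ with the row $\mathbf{v}_{i_1,i_2}$ appended, and $\mathcal{C}_{i_1,i_2}$ is the code with this parity check matrix. For a binary linear code $C$: $d(\mathbf{v},C)$ is the minimum Hamming distance from $\mathbf{v}$ to $C$, $\rho=\max_{\mathbf{v}}d(\mathbf{v},C)$ is the covering radius, and $C(l)=\{\mathbf{x}: d(\mathbf{x},C)=l\}$. $C$ is completely regular if for every $l$, every $\mathbf{x}\in C(l)$ has the same number $c_l$ of neighbors (vectors at Hamming distance 1) in $C(l-1)$ and the same number $b_l$ of neighbors in $C(l+1)$; its intersection array is $(b_0,\dots,b_{\rho-1};c_1,\dots,c_\rho)$. $\mathrm{Aut}(C)$ is the group of coordinate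 permutations preserving $C$, acting on cosets by $\pi(C+\mathbf{v})=C+\pi(\mathbf{v})$; $C$ is completely transitive if $\mathrm{Aut}(C)$ has exactly $\rho+1$ orbits on the cosets of $C$ (completely transitive codes are completely regular). A binary code is called antipodal if the complement of every codeword is a codeword (for a linear code: the all-one vector belongs to the code). *)

(* Defs.v *)
From HB Require Import structures.
From mathcomp Require Import all_boot all_order all_algebra all_fingroup.
From mathcomp Require Import all_solvable all_field.

Set Implicit Arguments.
Unset Strict Implicit.
Unset Printing Implicit Defensive.

Import GRing.Theory.
Local Open Scope ring_scope.

(* A binary linear code of length n is a subspace C : {vspace 'rV['F_2]_n}. *)

Section BinaryCodes.

Variable n : nat.
Implicit Types (x y v : 'rV['F_2]_n) (C : {vspace 'rV['F_2]_n}) (s : 'S_n).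

Definition wt x : nat := #|[set i | x 0 i != 0]|.

Definition hdist x y : nat := #|[set i | x 0 i != y 0 i]|.

(* The default value n of the minimum is harmless: 0 \in C and hdist <= n. *)
Definition dist_code v C : nat := \big[minn/n]_(c in C) hdist v c.

Definition covering_radius C : nat := \max_(v : 'rV['F_2]_n) dist_code v C.

Definition layer C (l : nat) : {set 'rV['F_2]_n} :=
  [set x | dist_code x C == l].

Definition neighbors x : {set 'rV['F_2]_n} := [set y | hdist x y == 1%N].

(* C(l - 1), with C(-1) empty. *)
Definition prev_layer C (l : nat) : {set 'rV['F_2]_n} :=
  if l is l'.+1 then layer C l' else set0.

(* C is completely regular iff this holds for some b and c. *)
Definition regular_parameters C (b c : nat -> nat) : Prop :=
  forall (l : nat) x, x \in layer C l ->
    #|neighbors x :&: layer C l.+1| = b l /\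
    #|neighbors x :&: prev_layer C l| = c l.

(* b = (b_0, ..., b_(rho - 1)) and c = (c_1, ..., c_rho); the boundary values *)
(* b_rho = c_0 = 0 are supplied by nth and by the leading 0.                  *)
Definition has_intersection_array C (b c : seq nat) : Prop :=
  [/\ size b = covering_radius C, size c = covering_radius C
    & regular_parameters C (nth 0%N b) (nth 0%N (0%N :: c))].

(* (perm_vec v s)_(s i) = v_i; with the composition order of 'S_n this is a   *)
(* right action, as required by action.v.                                     *)
Definition perm_vec v s : 'rV['F_2]_n := col_perm s^-1%g v.

Fact perm_vec1 : perm_vec^~ 1%g =1 id.
Proof. by move=> v; rewrite /perm_vec invg1 col_perm1. Qed.

Fact perm_vecM v : act_morph perm_vec v.
Proof. by move=> s t; rewrite /perm_vec invMg col_permM. Qed.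

Canonical perm_vec_action := TotalAction perm_vec1 perm_vecM.

Definition code_set C : {set 'rV['F_2]_n} := [set x in C].

Definition code_coset C v : {set 'rV['F_2]_n} := [set c + v | c in C].

Definition code_cosets C : {set {set 'rV['F_2]_n}} :=
  [set code_coset C v | v : 'rV['F_2]_n].

Definition code_aut C : {set 'S_n} := 'N(code_set C | perm_vec_action)%g.

Lemma code_aut_coset C s v :
  s \in code_aut C ->
  setact perm_vec_action (code_coset C v) s = code_coset C (perm_vec v s).
Proof.
move=> sC; have memC c : (perm_vec c s \in C) = (c \in C).
  by have := astabs_act c sC; rewrite !inE.
have permD u w : perm_vec (u + w) s = perm_vec u s + perm_vec w s.
  by rewrite /perm_vec; apply/rowP=> j; rewrite !mxE.
apply/setP=> x; apply/imsetP/imsetP=> [[_ /imsetP[c cC ->] ->] | [c cC ->]].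
  by exists (perm_vec c s); rewrite ?memC //= permD.
exists (perm_vec c s^-1%g + v); last by rewrite /= permD -perm_vecM mulVg perm_vec1.
by apply: imset_f; rewrite -memC -perm_vecM mulVg perm_vec1.
Qed.

Definition completely_transitive C : Prop :=
  #|orbit (perm_vec_action^*)%act (code_aut C) @: code_cosets C|
    = (covering_radius C).+1.

Definition antipodal C : Prop := forall x, x \in C -> x + const_mx 1 \in C.

Definition min_distance C (d : nat) : Prop :=
  (forall x y, x \in C -> y \in C -> x != y -> (d <= hdist x y)%N) /\
  (exists x y, [/\ x \in C, y \in C, x != y & hdist x y = d]).

(* C is an [n, k, d] code. *)
Definition code_parameters C (k d : nat) : Prop :=
  \dim C = k /\ min_distance C d.

Definition even_weight_subcode C : {set 'rV['F_2]_n} :=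
  [set x in C | ~~ odd (wt x)].

Definition parity_check_code r (H : 'M['F_2]_(r, n)) : {vspace 'rV['F_2]_n} :=
  lker (linfun (mulmxr H^T : 'rV['F_2]_n -> 'rV['F_2]_r)).

Lemma mem_parity_check_code r (H : 'M['F_2]_(r, n)) x :
  (x \in parity_check_code H) = (H *m x^T == 0).
Proof.
by rewrite memv_ker lfunE /= -(inj_eq (@trmx_inj _ _ _)) trmx_mul trmxK trmx0.
Qed.

End BinaryCodes.

Section Construction.

Variables (L : fieldExtType 'F_2) (alpha : L) (m : nat).

Definition power_basis : m.-tuple L := [tuple alpha ^+ i | i < m].

Definition hamming_mx : 'M['F_2]_(m, 2 ^ m - 1) :=
  \matrix_(i < m, j < 2 ^ m - 1) coord power_basis i (alpha ^+ j).

Definition hamming_code := parity_check_code hamming_mx.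

Definition weight_row (i1 i2 : nat) : 'rV['F_2]_(2 ^ m - 1) :=
  \row_j (let w := wt (col j hamming_mx)^T in
          (w == i1 %[mod 4]) || (w == i2 %[mod 4]))%:R.

Definition extended_mx (i1 i2 : nat) : 'M['F_2]_(m + 1, 2 ^ m - 1) :=
  col_mx hamming_mx (weight_row i1 i2).

Definition weight_code (i1 i2 : nat) := parity_check_code (extended_mx i1 i2).

End Construction.

(* Main.v *)
Require Import Defs.
From HB Require Import structures.
From mathcomp Require Import all_boot all_order all_algebra all_fingroup.
From mathcomp Require Import all_solvable all_field.

(** The cosets of the code are its syndromes (w, t) in F_2^m x F_2, where the
    column at a nonzero vector u has syndrome (u, f u).  In every case
    f (u + v) = f u + f v + e B(u, v) + c for constants e and c, where
    B(u, v) = (sum u)(sum v) + <u, v> is alternating, and nondegenerate because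
    m is even.  Distances to the code are then read off syndromes: (0, 0) is at
    distance 0, (w, f w) at distance 1, (w, f w + 1) at distance 2 and (0, 1) at
    distance 3, and the intersection numbers count the u with
    e B(u, w) + c = 1.  A transvection u |-> u + B(u, a) a permutes the columns
    and changes f by a linear function, hence is an automorphism of the code;
    transvections are transitive on nonzero vectors, so there are four orbits.
    The all-one vector has syndrome (0, c), because f has degree at most 2 and
    sums to 0 over F_2^m, while f 0 = c is not attached to any column. *)

Set Implicit Arguments.
Unset Strict Implicit.
Unset Printing Implicit Defensive.

Import GRing.Theory.
Local Open Scope nat_scope.

(** * Binary vectors: weight, distance to a code, cosets and coordinate permutations *)

Section BinaryVectors.

Local Open Scope ring_scope.

Lemma F2_0or1 (a : 'F_2) : a = 0 \/ a = 1.
Proof. by case: a => [[|[|//]]] i; [left|right]; apply/val_inj. Qed.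

Lemma F2_neq0 (a : 'F_2) : (a != 0) = (a == 1).
Proof. by case: (F2_0or1 a) => ->. Qed.

Lemma F2_addrr (a : 'F_2) : a + a = 0.
Proof. by case: (F2_0or1 a) => ->; apply/val_inj. Qed.

Lemma F2_natr_odd k : k%:R = (odd k)%:R :> 'F_2.
Proof. by rewrite -[k in LHS]odd_double_half -addnn !natrD F2_addrr addr0. Qed.

Lemma F2_natr_eq0 k : ((k%:R : 'F_2) == 0) = ~~ odd k.
Proof. by rewrite F2_natr_odd; case: (odd k). Qed.

Lemma F2_mx_addrr m n (A : 'M['F_2]_(m, n)) : A + A = 0.
Proof. by apply/matrixP=> i j; rewrite !mxE F2_addrr. Qed.

Lemma F2_mx_opp m n (A : 'M['F_2]_(m, n)) : - A = A.
Proof. by apply/eqP; rewrite eq_sym -subr_eq0 opprK F2_mx_addrr. Qed.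

Variable n : nat.
Implicit Types (x y v : 'rV['F_2]_n) (C : {vspace 'rV['F_2]_n}).

Lemma wt_natr x : (wt x)%:R = \sum_j x 0 j.
Proof.
rewrite /wt -sum1_card natr_sum big_mkcond /=; apply: eq_bigr => j _.
by rewrite inE; case: (F2_0or1 (x 0 j)) => ->.
Qed.

Lemma wt0 : wt (0 : 'rV['F_2]_n) = 0%N.
Proof. by apply/eqP; rewrite cards_eq0; apply/eqP/setP=> j; rewrite !inE mxE eqxx. Qed.

Lemma wt_eq0 x : (wt x == 0%N) = (x == 0).
Proof.
apply/eqP/eqP=> [/eqP|->]; last exact: wt0.
rewrite cards_eq0 => /eqP/setP x0; apply/rowP=> j.
by have := x0 j; rewrite !inE mxE => /negbFE/eqP.
Qed.

Lemma hdist_wt x y : hdist x y = wt (x - y).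
Proof. by apply: eq_card => j; rewrite !inE !mxE subr_eq0. Qed.

Lemma wtD x y : (wt (x + y) <= wt x + wt y)%N.
Proof.
apply: leq_trans (leq_card_setU _ _); apply/subset_leq_card/subsetP=> j.
by rewrite !inE mxE; case: (F2_0or1 (x 0 j)) => ->; rewrite ?add0r.
Qed.

Lemma wt_le x : (wt x <= n)%N.
Proof. by rewrite -[n in (_ <= n)%N]card_ord max_card. Qed.

Lemma wt_delta j : wt (delta_mx 0 j : 'rV['F_2]_n) = 1%N.
Proof.
by apply/eqP/cards1P; exists j; apply/setP=> i; rewrite !inE mxE eqxx /=; case: (i == j).
Qed.

Lemma wt_eq1P x : reflect (exists j, x = delta_mx 0 j) (wt x == 1%N).
Proof.
apply: (iffP cards1P) => [[j xj]|[j ->]]; exists j.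
  apply/rowP=> i; rewrite mxE eqxx /=.
  have /setP/(_ i) := xj; rewrite !inE => <-.
  by case: (F2_0or1 (x 0 i)) => ->.
by apply/setP=> i; rewrite !inE mxE eqxx /=; case: (i == j).
Qed.

Lemma wt_add_delta x j : x 0 j != 0 -> (wt (x + delta_mx 0 j)).+1 = wt x.
Proof.
move=> xj; rewrite /wt (cardsD1 j [set i | x 0 i != 0]) inE xj; congr _.+1.
apply: eq_card => i; rewrite !inE !mxE eqxx /=; have [->|_] := eqVneq i j.
  by move: xj; rewrite F2_neq0 => /eqP->.
by rewrite addr0.
Qed.

Lemma delta_mx_inj : injective (fun j => delta_mx 0 j : 'rV['F_2]_n).
Proof.
move=> i j /rowP/(_ i); rewrite !mxE !eqxx /=.
by case: eqP.
Qed.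

Lemma dist_code_leP v C k :
  reflect (exists2 c, c \in C & (hdist v c <= k)%N) (dist_code v C <= k)%N.
Proof.
apply: (iffP idP) => [le_k|[c cC]]; last first.
  by apply: leq_trans; apply: (Order.TotalTheory.bigmin_le_cond n (hdist v)).
suff [c cC lec] : exists2 c, c \in C & (hdist v c <= dist_code v C)%N.
  by exists c => //; apply: leq_trans le_k.
(* The default value [n] is at least the distance to the codeword 0, so it satisfies the claim as
   well. *)
rewrite /dist_code; elim/big_ind: _ => [|a b [c cC ca] [d dC db]|c cC].
- by exists 0; rewrite ?mem0v // hdist_wt wt_le.
- by rewrite /minn; case: ifP => _; [exists c | exists d].
- by exists c.
Qed.

Lemma wt_perm_vec x s : wt (perm_vec x s) = wt x.
Proof.
rewrite /wt -(card_imset [set j | x 0 j != 0] (@perm_inj _ s)).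
apply: eq_card => j; rewrite !inE /perm_vec mxE.
apply/idP/imsetP => [xj|[i]]; last by rewrite inE => xi ->; rewrite permK.
by exists (s^-1%g j); rewrite ?inE // permKV.
Qed.

Lemma perm_vecB x y s : perm_vec (x - y) s = perm_vec x s - perm_vec y s.
Proof. by apply/rowP=> j; rewrite !mxE. Qed.

Lemma perm_vec_mem C s v : s \in code_aut C -> (perm_vec v s \in C) = (v \in C).
Proof. by move=> sC; have := astabs_act v sC; rewrite !inE. Qed.

Lemma dist_code_perm C s v :
  s \in code_aut C -> dist_code (perm_vec v s) C = dist_code v C.
Proof.
have le t u : t \in code_aut C -> (dist_code (perm_vec u t) C <= dist_code u C)%N.
  move=> tC; have /dist_code_leP[c cC le_c] := leqnn (dist_code u C).
  apply/dist_code_leP; exists (perm_vec c t); first by rewrite perm_vec_mem.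
  by rewrite hdist_wt -perm_vecB wt_perm_vec -hdist_wt.
move=> sC; apply/eqP; rewrite eqn_leq le //=.
by rewrite -{1}[v](actK (perm_vec_action n) s) /= le // /code_aut groupV.
Qed.

Lemma dist_code_coset C v c : c \in C -> dist_code (c + v) C = dist_code v C.
Proof.
have le u d : d \in C -> (dist_code (d + u) C <= dist_code u C)%N.
  move=> dC; have /dist_code_leP[e eC le_e] := leqnn (dist_code u C).
  apply/dist_code_leP; exists (d + e); first exact: memvD.
  by rewrite hdist_wt opprD addrACA subrr add0r -hdist_wt.
move=> cC; apply/eqP; rewrite eqn_leq le //=.
by rewrite -{1}[v](addKr c) le // memvN.
Qed.

Lemma mem_code_coset C u v : (u \in code_coset C v) = (u - v \in C).
Proof.
apply/imsetP/idP=> [[c cC ->]|uvC]; first by rewrite addrK.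
by exists (u - v); rewrite ?subrK.
Qed.

Lemma code_coset_eq C u v : (code_coset C u == code_coset C v) = (u - v \in C).
Proof.
apply/eqP/idP=> [uv|uvC]; first by rewrite -mem_code_coset -uv mem_code_coset subrr mem0v.
by apply/setP=> x; rewrite !mem_code_coset -[x - v](subrKA u) (rpredDr _ uvC).
Qed.

Lemma neighborsE x : neighbors x = [set x + delta_mx 0 j | j : 'I_n].
Proof.
apply/setP=> y; rewrite inE hdist_wt; apply/wt_eq1P/imsetP => [[j xy]|[j _ ->]].
  by exists j => //; rewrite -xy -[x - y]F2_mx_opp opprB addrC subrK.
by exists j; rewrite opprD addrA subrr sub0r F2_mx_opp.
Qed.

End BinaryVectors.

(** * Syndromes: distances and intersection numbers when the columns are all nonzero vectors *)

Section SyndromeCode.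

Local Open Scope ring_scope.

Variables (m n : nat) (H : 'M['F_2]_(m, n)) (f : 'cV['F_2]_m -> 'F_2).

Hypothesis n_gt0 : (0 < n)%N.
Hypothesis col_inj : injective (fun j => col j H).
Hypothesis col_neq0 : forall j, col j H != 0.
Hypothesis col_onto : forall w, w != 0 -> exists j, col j H = w.

Let C := parity_check_code (col_mx H (\row_j f (col j H))).

(** The product of the check matrix with [x], split into the part of [H] and the part of the
    appended row, so that syndromes add as pairs. *)
Definition syndrome (x : 'rV['F_2]_n) : 'cV['F_2]_m * 'F_2 :=
  (\sum_j x 0 j *: col j H, \sum_j x 0 j * f (col j H)).

Lemma syndrome0 : syndrome 0 = 0.
Proof.
by congr (_, _); rewrite big1 // => j _; rewrite mxE ?scale0r ?mul0r.
Qed.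

Lemma syndromeD x y : syndrome (x + y) = syndrome x + syndrome y.
Proof.
by congr (_, _); rewrite -big_split /=; apply: eq_bigr => j _;
  rewrite mxE ?scalerDl ?mulrDl.
Qed.

Lemma syndrome_delta j : syndrome (delta_mx 0 j) = (col j H, f (col j H)).
Proof.
by congr (_, _); rewrite (bigD1 j) //= !mxE !eqxx ?scale1r ?mul1r big1 ?addr0 // => i ij;
  rewrite mxE eqxx (negbTE ij) ?scale0r ?mul0r.
Qed.

Lemma mulmx_syndrome x :
  col_mx H (\row_j f (col j H)) *m x^T
    = col_mx (syndrome x).1 ((syndrome x).2)%:M.
Proof.
rewrite mul_col_mx; congr col_mx.
  apply/colP=> i; rewrite !mxE summxE; apply: eq_bigr => j _.
  by rewrite !mxE mulrC.
apply/matrixP=> i k; rewrite !ord1 !mxE /= mulr1n; apply: eq_bigr => j _.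
by rewrite !mxE mulrC.
Qed.

Lemma mem_syndrome x : (x \in C) = (syndrome x == 0).
Proof.
rewrite mem_parity_check_code mulmx_syndrome.
case: (syndrome x) => w t /=; rewrite -pair_eqE /=.
have -> : (t == 0) = (t%:M == 0 :> 'M_1).
  apply/eqP/eqP=> [->|/matrixP/(_ 0 0)]; first exact: raddf0.
  by rewrite !mxE.
apply/eqP/andP=> [|[/eqP-> /eqP->]]; last by rewrite col_mx0.
by rewrite -[0]vsubmxK => /eq_col_mx[-> ->]; rewrite !linear0 !eqxx.
Qed.

Lemma mem_hamming_syndrome x : (x \in parity_check_code H) = ((syndrome x).1 == 0).
Proof.
rewrite mem_parity_check_code; congr (_ == 0).
by have := mulmx_syndrome x; rewrite mul_col_mx => /eq_col_mx[].
Qed.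

Lemma syndrome_eq x y : (x - y \in C) = (syndrome x == syndrome y).
Proof.
rewrite mem_syndrome -[- y]F2_mx_opp opprK syndromeD.
rewrite -[RHS]subr_eq0; congr (_ == 0); congr (_ + _).
by apply/eqP; rewrite -subr_eq0 opprK -syndromeD F2_mx_addrr syndrome0.
Qed.

(* The distance from a vector of syndrome s to the code. *)
Definition level (s : 'cV['F_2]_m * 'F_2) : nat :=
  if s.1 == 0 then (if s.2 == 0 then 0 else 3)
  else if s.2 == f s.1 then 1 else 2.

Lemma level_le3 s : (level s <= 3)%N.
Proof. by rewrite /level; do !case: ifP. Qed.

Lemma level_add_col0 t j :
  level ((0, t) + (col j H, f (col j H))) = if t == 0 then 1%N else 2%N.
Proof.
rewrite /level /= add0r (negbTE (col_neq0 j)).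
by case: (F2_0or1 t) (F2_0or1 (f (col j H))) => -> [] ->.
Qed.

(** Only the column equal to [w] cancels the first component. Any other column [u] keeps the level
    in {1, 2} if [f] is additive on [w] and [u], and exchanges 1 and 2 otherwise. *)
Lemma level_add_col w t j : w != 0 ->
  level ((w, t) + (col j H, f (col j H))) =
    if col j H == w then (if t == f w then 0%N else 3%N)
    else if (t == f w) == (f (w + col j H) == f w + f (col j H)) then 1%N else 2%N.
Proof.
move=> w0; rewrite /level /= addr_eq0 F2_mx_opp eq_sym; case: eqP => [->|_].
  by case: (F2_0or1 t) (F2_0or1 (f w)) => -> [] ->.
congr (if _ then _ else _).
by case: (F2_0or1 t) (F2_0or1 (f w)) (F2_0or1 (f (col j H)))
  (F2_0or1 (f (w + col j H))) => -> [] -> [] -> [] ->.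
Qed.

Lemma level_add_col_le (s : 'cV['F_2]_m * 'F_2) j :
  (level ((col j H, f (col j H)) + s)%R <= (level s).+1)%N.
Proof.
case: s => w t; rewrite addrC; have [->|w0] := eqVneq w 0.
  by rewrite level_add_col0 /level /= eqxx; case: (t == 0).
rewrite level_add_col // /level /= (negbTE w0).
by do !case: ifP.
Qed.

(** The common value of b_1 and c_2: the number of columns that exchange levels 1 and 2, assumed to
    be the same for every nonzero [w]. *)
Variable N : nat.
Hypothesis N_gt0 : (0 < N)%N.
Hypothesis defect_card : forall w, w != 0 ->
  #|[set j | (col j H != w) && (f (w + col j H) != f w + f (col j H))]| = N.

Let card_col w : w != 0 -> #|[set j | col j H == w]| = 1%N.
Proof.
move=> /col_onto[j <-]; apply/eqP/cards1P; exists j; apply/setP=> i.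
by rewrite !inE (inj_eq col_inj).
Qed.

(** Every column leads from level 0 to 1, the [N] columns where additivity fails lead from 1 to 2,
    and only the column [w] leads from 2 to 3. The default of [nth] gives 0 at level 3. *)
Lemma card_level_up (s : 'cV['F_2]_m * 'F_2) :
  #|[set j | level (s + (col j H, f (col j H))) == (level s).+1]|
    = nth 0%N [:: n; N; 1%N] (level s).
Proof.
case: s => w t; have [->|w0] := eqVneq w 0.
  have -> : level (0, t) = if t == 0 then 0%N else 3%N by rewrite /level /= eqxx.
  case t0: (t == 0) => /=.
    by rewrite -[RHS]card_ord -cardsT; apply: eq_card => j;
    rewrite !inE level_add_col0 t0.
  by apply/eqP; rewrite cards_eq0; apply/eqP/setP=> j; rewrite !inE level_add_col0 t0.
have -> : level (w, t) = if t == f w then 1%N else 2%N.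
  by rewrite /level /= (negbTE w0).
case tw: (t == f w) => /=.
  rewrite -(defect_card w0); apply: eq_card => j; rewrite !inE level_add_col // tw.
  by case: (col j H == w) => //=; case: (_ == _ + _).
rewrite -[RHS](card_col w0); apply: eq_card => j; rewrite !inE level_add_col // tw.
by case: (col j H == w) => //=; case: ifP.
Qed.

(** The mirror image of [card_level_up]. The successor on the left makes the count 0 at level 0
    without truncated subtraction. *)
Lemma card_level_down (s : 'cV['F_2]_m * 'F_2) :
  #|[set j | (level (s + (col j H, f (col j H)))).+1 == level s]|
    = nth 0%N [:: 0%N; 1%N; N; n] (level s).
Proof.
case: s => w t; have [->|w0] := eqVneq w 0.
  have -> : level (0, t) = if t == 0 then 0%N else 3%N by rewrite /level /= eqxx.
  case t0: (t == 0) => /=.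
    by apply/eqP; rewrite cards_eq0; apply/eqP/setP=> j; rewrite !inE level_add_col0 t0.
  by rewrite -[RHS]card_ord -cardsT; apply: eq_card => j;
    rewrite !inE level_add_col0 t0.
have -> : level (w, t) = if t == f w then 1%N else 2%N.
  by rewrite /level /= (negbTE w0).
case tw: (t == f w) => /=.
  rewrite -[RHS](card_col w0); apply: eq_card => j; rewrite !inE level_add_col // tw.
  by case: (col j H == w) => //=; case: ifP.
rewrite -(defect_card w0); apply: eq_card => j; rewrite !inE level_add_col // tw.
by case: (col j H == w) => //=; case: (_ == _ + _).
Qed.

(** The vector is a sum of [wt x] unit vectors, and each raises the level by at most one. *)
Lemma level_wt x : (level (syndrome x) <= wt x)%N.
Proof.
have {1}-> : x = \sum_(j in [set j | x 0 j != 0]) delta_mx 0 j.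
  rewrite {1}[x]row_sum_delta [RHS]big_mkcond; apply: eq_bigr => j _.
  by rewrite inE; case: (F2_0or1 (x 0 j)) => ->; rewrite ?scale0r ?scale1r.
rewrite /wt -sum1_card; elim/big_rec2: _ => [|j k y _ IH].
  by rewrite syndrome0 /level /= !eqxx.
by rewrite syndromeD syndrome_delta; apply: leq_trans (level_add_col_le _ _) _.
Qed.

(** Descent: by [card_level_down] some column leads down from every positive level; at level 2 this
    is the positivity of [N]. *)
Lemma exists_wt_level s : exists2 x, syndrome x = s & (wt x <= level s)%N.
Proof.
move lk : (level s) => k; elim: k s lk => [|k IH] s lk.
  exists 0; last by rewrite wt0.
  rewrite syndrome0; case: s lk => w t; rewrite /level /=.
  by have [->|_] := eqVneq w 0; case: eqP => // ->.
have /card_gt0P[j] :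
    (0 < #|[set j | (level (s + (col j H, f (col j H)))%R).+1 == level s]|)%N.
  rewrite card_level_down lk; have := level_le3 s; rewrite lk.
  by case: (k) => [|[|[|]]].
rewrite inE lk eqSS => /eqP/IH[x xs wx]; exists (x + delta_mx 0 j).
  rewrite syndromeD xs syndrome_delta -addrA -syndrome_delta -syndromeD.
  by rewrite F2_mx_addrr syndrome0 addr0.
by apply: leq_trans (wtD _ _) _; rewrite wt_delta addn1.
Qed.

(** The distance is the least weight among vectors with the syndrome of [x]. The upper bound is
    [exists_wt_level], the lower bound [level_wt]. *)
Lemma dist_code_level x : dist_code x C = level (syndrome x).
Proof.
apply/eqP; rewrite eqn_leq; apply/andP; split.
  have [y sy wy] := exists_wt_level (syndrome x).
  apply/dist_code_leP; exists (x - y); first by rewrite syndrome_eq sy.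
  by rewrite hdist_wt opprB addrC subrK.
have /dist_code_leP[c cC] := leqnn (dist_code x C); apply: leq_trans.
rewrite hdist_wt; apply: leq_trans (level_wt _); rewrite eq_leq //; congr level.
by apply/esym/eqP; rewrite -syndrome_eq addrAC subrr sub0r rpredN.
Qed.

Lemma exists_level k : (k < 4)%N -> exists s, level s = k.
Proof.
have w0 := col_neq0 (Ordinal n_gt0); set w := col _ H in w0.
case: k => [|[|[|[|//]]]] _.
- by exists (0, 0); rewrite /level /= !eqxx.
- by exists (w, f w); rewrite /level /= (negbTE w0) eqxx.
- exists (w, f w + 1); rewrite /level /= (negbTE w0).
  by case: (F2_0or1 (f w)) => ->.
- by exists (0, 1); rewrite /level /= eqxx.
Qed.

Lemma covering_radius_syndrome : covering_radius C = 3.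
Proof.
apply/eqP; rewrite eqn_leq; apply/andP; split.
  by apply/bigmax_leqP=> x _; rewrite dist_code_level level_le3.
have [s s3] := @exists_level 3 isT; have [x xs _] := exists_wt_level s.
by rewrite /covering_radius (bigD1 x) //= dist_code_level xs s3 leq_maxl.
Qed.

Lemma card_neighbors (x : 'rV['F_2]_n) (P : pred nat) :
  #|[set y in neighbors x | P (dist_code y C)]|
    = #|[set j | P (level (syndrome x + (col j H, f (col j H))))]|.
Proof.
rewrite neighborsE -(card_imset _ (inj_comp (addrI x) (@delta_mx_inj n))).
apply: eq_card => y; rewrite !inE; apply/andP/imsetP=> [[/imsetP[j _ ->] Py]|[j]].
  by exists j => //; rewrite inE -syndrome_delta -syndromeD -dist_code_level.
rewrite inE -syndrome_delta -syndromeD -dist_code_level => Py ->.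
by split => //; apply: imset_f.
Qed.

Lemma intersection_array_syndrome :
  has_intersection_array C [:: n; N; 1%N] [:: 1%N; N; n].
Proof.
split; rewrite ?covering_radius_syndrome // => l x.
rewrite inE dist_code_level => /eqP <-; split.
  rewrite -card_level_up -(card_neighbors x (eq_op^~ (level (syndrome x)).+1)).
  by apply: eq_card => y; rewrite !inE.
rewrite -card_level_down -(card_neighbors x (fun k => k.+1 == level (syndrome x))).
apply: eq_card => y; rewrite !inE /prev_layer.
by case: (level _) => [|k]; rewrite !inE ?eqSS ?andbF.
Qed.

(** Rank-nullity: the parity check map is onto, because every syndrome occurs. *)
Lemma dim_syndrome_code : (\dim C + (m + 1) = n)%N.
Proof.
have := limg_ker_dim (linfun (mulmxr (col_mx H (\row_j f (col j H)))^T
  : 'rV['F_2]_n -> 'rV['F_2]_(m + 1))) fullv.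
rewrite capfv -/C; set g := linfun _.
have -> : limg g = fullv.
  apply/eqP; rewrite eqEsubv subvf; apply/subvP=> y _.
  have [x xy _] := exists_wt_level (usubmx y^T, dsubmx y^T 0 0).
  apply/memv_imgP; exists x; rewrite ?memvf // lfunE /=.
  apply: trmx_inj; rewrite trmx_mul trmxK mulmx_syndrome xy /=.
  by rewrite -mx11_scalar vsubmxK.
by rewrite !dimvf /dim /= !mul1n.
Qed.

(** * Transvections as automorphisms, and their orbits on cosets *)

Variables (B : 'cV['F_2]_m -> 'cV['F_2]_m -> 'F_2) (e c : 'F_2).
Hypothesis B_addl : forall u v w, B (u + v) w = B u w + B v w.
Hypothesis B_sym : forall u v, B u v = B v u.
Hypothesis B_alt : forall u, B u u = 0.
Hypothesis B_nondeg : forall w, w != 0 -> exists u, B u w = 1.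
Hypothesis f_polar : forall u v, f (u + v) = f u + f v + e * B u v + c.

Let B0 a : B 0 a = 0.
Proof. by apply: (addrI (B 0 a)); rewrite -B_addl !addr0. Qed.

Let B_scalel k u a : B (k *: u) a = k * B u a.
Proof.
by case: (F2_0or1 k) => ->; rewrite ?scale0r ?scale1r ?mul0r ?mul1r.
Qed.

Let B_suml (x : 'rV['F_2]_n) (u : 'I_n -> 'cV['F_2]_m) a :
  B (\sum_j x 0 j *: u j) a = \sum_j x 0 j * B (u j) a.
Proof.
rewrite (big_morph (B^~ a) (fun u v => B_addl u v a) (B0 a)).
by apply: eq_bigr => j _; rewrite B_scalel.
Qed.

Definition transvection a u := u + B u a *: a.

Lemma transvectionK a : involutive (transvection a).
Proof.
move=> u; rewrite /transvection B_addl B_scalel B_alt mulr0 addr0.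
by rewrite -addrA F2_mx_addrr addr0.
Qed.

Lemma transvection0 a : transvection a 0 = 0.
Proof. by rewrite /transvection B0 scale0r addr0. Qed.

(** If B(u, a) = 1, then [f_polar] gives f (u + a) = f u + f a + e + c. So [f] changes by B(u, a)
    times a constant, which is linear in [u]. *)
Lemma f_transvection a u : f (transvection a u) = f u + B u a * (f a + e + c).
Proof.
rewrite /transvection; case: (F2_0or1 (B u a)) => Bua; rewrite Bua.
  by rewrite scale0r mul0r !addr0.
by rewrite scale1r mul1r f_polar Bua mulr1 !addrA.
Qed.

(** The transvection is a bijection fixing 0, so it permutes the columns. As [f] changes by a linear
    function, the new syndrome is a function of the old one, and it sends 0 to 0. *)
Lemma transvection_aut a :
  exists2 s, s \in code_aut C & forall x, syndrome (perm_vec x s) =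
    (transvection a (syndrome x).1,
     (syndrome x).2 + B (syndrome x).1 a * (f a + e + c)).
Proof.
have [t tE] : exists t : 'I_n -> 'I_n, forall j, col (t j) H = transvection a (col j H).
  apply: (@fin_all_exists _ (fun=> 'I_n)
    (fun j i => col i H = transvection a (col j H))) => j; apply: col_onto.
  by rewrite -(inj_eq (can_inj (transvectionK a))) transvectionK transvection0.
have t_inj : injective t.
  move=> i j ij; apply: col_inj; apply: (can_inj (transvectionK a)).
  by rewrite -!tE ij.
have synE x : syndrome (perm_vec x (perm t_inj)) =
    (transvection a (syndrome x).1,
     (syndrome x).2 + B (syndrome x).1 a * (f a + e + c)).
  congr (_, _); rewrite (reindex_inj (@perm_inj _ (perm t_inj))) /=.
    rewrite /transvection B_suml scaler_suml -big_split; apply: eq_bigr => j _ /=.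
    by rewrite /perm_vec mxE permK permE tE scalerDr scalerA.
  rewrite B_suml mulr_suml -big_split; apply: eq_bigr => j _ /=.
  by rewrite /perm_vec mxE permK permE tE f_transvection mulrDr mulrA.
exists (perm t_inj) => //; rewrite !inE; apply/subsetP=> x; rewrite !inE /=.
rewrite !mem_syndrome synE => /eqP->.
by rewrite /= transvection0 B0 mul0r add0r.
Qed.

(** Take [a] and [b] not orthogonal to [u] and [v] respectively. If neither serves both, then B(v,
    a) = B(u, b) = 0 and [a + b] does. *)
Lemma exists_B_pair u v : u != 0 -> v != 0 -> exists w, B u w = 1 /\ B v w = 1.
Proof.
move=> /B_nondeg[a ua] /B_nondeg[b vb].
have [va|va] := F2_0or1 (B v a); last by exists a; rewrite B_sym.
have [ub|ub] := F2_0or1 (B u b); last by exists b; rewrite [B v b]B_sym.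
exists (a + b); rewrite ![B _ (a + b)]B_sym !B_addl ua vb.
by rewrite [B b u]B_sym [B a v]B_sym va ub addr0 add0r.
Qed.

(** The transvection along u + w takes u to w, since B(u, u + w) = B(u, w) = 1; its constant f (u +
    w) + e + c reduces to f u + f w. *)
Lemma aut_move_hyperbolic x w : B (syndrome x).1 w = 1 ->
  exists2 s, s \in code_aut C &
    syndrome (perm_vec x s) = (w, (syndrome x).2 + f (syndrome x).1 + f w).
Proof.
set u := (syndrome x).1 => Buw; have [s sC sE] := transvection_aut (u + w).
have Bu : B u (u + w) = 1 by rewrite B_sym B_addl B_alt add0r B_sym.
exists s => //; rewrite sE; congr (_, _); rewrite -/u /transvection Bu.
  by rewrite scale1r addrA F2_mx_addrr add0r.
rewrite mul1r f_polar Buw mulr1 -!addrA; congr (_ + (_ + _)).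
by rewrite [c + (e + c)]addrCA F2_addrr addr0 F2_addrr addr0.
Qed.

(** Two moves through a vector [v] orthogonal to neither end; the two terms [f v] cancel. *)
Lemma aut_move x w : (syndrome x).1 != 0 -> w != 0 ->
  exists2 s, s \in code_aut C &
    syndrome (perm_vec x s) = (w, (syndrome x).2 + f (syndrome x).1 + f w).
Proof.
move=> x0 w0; have [v [xv wv]] := exists_B_pair x0 w0.
have [s sC sE] := aut_move_hyperbolic xv.
have [|t tC tE] := @aut_move_hyperbolic (perm_vec x s) w; first by rewrite sE B_sym.
exists (s * t)%g; first by rewrite /code_aut groupM.
rewrite perm_vecM tE sE /=; congr (_, _ + _).
by rewrite -addrA F2_addrr addr0.
Qed.

(** If the first component is 0, the level determines the syndrome. Otherwise [aut_move] preserves t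
    + f w, the bit separating levels 1 and 2. *)
Lemma aut_orbit_level x y (lxy : level (syndrome x) = level (syndrome y)) :
  exists2 s, s \in code_aut C & syndrome (perm_vec x s) = syndrome y.
Proof.
have [x0|x0] := eqVneq (syndrome x).1 0.
  exists 1%g; first by rewrite /code_aut group1.
  rewrite perm_vec1; move: x0 lxy; case: (syndrome x) (syndrome y) => w t [w' t'].
  rewrite /level /= => ->; rewrite eqxx.
  have [->|_] := eqVneq w' 0; last by do !case: ifP.
  by case: (F2_0or1 t) (F2_0or1 t') => -> [] ->.
have [y0|y0] := eqVneq (syndrome y).1 0.
  by move: lxy; rewrite /level y0 eqxx (negbTE x0); do !case: ifP.
have [s sC sE] := aut_move x0 y0; exists s => //; rewrite {}sE.
rewrite [RHS]surjective_pairing; congr (_, _); apply/eqP; move: lxy.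
rewrite /level (negbTE x0) (negbTE y0).
by case: (F2_0or1 (syndrome x).2) (F2_0or1 (syndrome y).2) (F2_0or1 (f (syndrome x).1))
  (F2_0or1 (f (syndrome y).1)) => -> [] -> [] -> [] ->.
Qed.

Lemma orbit_coset_eq x y :
  (orbit (perm_vec_action n)^*%act (code_aut C) (code_coset C x)
    == orbit (perm_vec_action n)^*%act (code_aut C) (code_coset C y))
  = (level (syndrome x) == level (syndrome y)).
Proof.
apply/eqP/eqP=> [/orbit_eqP/imsetP[s sC]|/esym/aut_orbit_level[s sC sE]].
  rewrite /= code_aut_coset // => /eqP; rewrite code_coset_eq => xC.
  rewrite -!dist_code_level -(dist_code_perm y sC).
  by rewrite -(dist_code_coset (perm_vec y s) xC) subrK.
apply/orbit_eqP/imsetP; exists s => //=; rewrite code_aut_coset //.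
by apply/eqP; rewrite code_coset_eq syndrome_eq sE.
Qed.

Lemma completely_transitive_syndrome : completely_transitive C.
Proof.
rewrite /completely_transitive covering_radius_syndrome.
(* One vector for each level 0, 1, 2, 3; the orbits of their cosets list all orbits without
   repetition. *)
have [r rE] : exists r : 'I_4 -> 'rV['F_2]_n, forall k, level (syndrome (r k)) = k.
  apply: (@fin_all_exists _ (fun=> 'rV_n)
    (fun (k : 'I_4) x => level (syndrome x) = k)) => k.
  have [s <-] := exists_level (ltn_ord k).
  by have [x <-] := exists_wt_level s; exists x.
rewrite /code_cosets -imset_comp -[RHS]card_ord.
set O := _ \o _.
have O_eq x y : (O x == O y) = (level (syndrome x) == level (syndrome y)).
  exact: orbit_coset_eq.
rewrite -[RHS](card_imset _ (f := O \o r)).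
  apply: eq_card => X; apply/imsetP/imsetP=> [[x _ ->]|[k _ ->]]; last by exists (r k).
  exists (Ordinal (level_le3 (syndrome x) : (_ < 4)%N)) => //=.
  by apply/eqP; rewrite O_eq rE.
by move=> i j /eqP; rewrite /= O_eq !rE => /eqP/val_inj.
Qed.

End SyndromeCode.

(** * Indicators of weights modulo 4 and their alternating polar form *)

Section WeightModFour.

Local Open Scope ring_scope.

Variable m : nat.
Implicit Types u v w : 'cV['F_2]_m.

(** This is the sum of u_i v_j over i != j, the polar form of the second elementary symmetric
    polynomial, whose value is the second binary digit of the weight. *)
Definition weight_form u v : 'F_2 :=
  (\sum_i u i 0) * (\sum_i v i 0) + \sum_i u i 0 * v i 0.

Lemma weight_formDl u v w :
  weight_form (u + v) w = weight_form u w + weight_form v w.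
Proof.
rewrite /weight_form addrACA -mulrDl -!big_split /=.
by congr (_ * _ + _); apply: eq_bigr => i _; rewrite mxE ?mulrDl.
Qed.

Lemma weight_form_sym u v : weight_form u v = weight_form v u.
Proof.
by rewrite /weight_form mulrC; congr (_ + _); apply: eq_bigr => i _; rewrite mulrC.
Qed.

(** Squaring is the identity on F_2, so both terms equal the sum of the coordinates. *)
Lemma weight_form_alt u : weight_form u u = 0.
Proof.
rewrite /weight_form; under [X in _ + X]eq_bigr => i _.
  have -> : u i 0 * u i 0 = u i 0.
    by case: (F2_0or1 (u i 0)) => ->; rewrite ?mulr0 ?mulr1.
  over.
by case: (F2_0or1 (\sum_i u i 0)) => ->; apply/eqP.
Qed.

Lemma weight_form_delta i w : weight_form (delta_mx i 0) w = \sum_j w j 0 + w i 0.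
Proof.
have d0 j : j != i -> (delta_mx i 0 : 'cV['F_2]_m) j 0 = 0.
  by move=> ij; rewrite mxE (negbTE ij).
have di : (delta_mx i 0 : 'cV['F_2]_m) i 0 = 1 by rewrite mxE !eqxx.
rewrite /weight_form (bigD1 i) //= big1; last exact: d0.
rewrite [X in _ + X](bigD1 i) //= [X in _ + (_ + X)]big1.
  by rewrite di !addr0 !mul1r.
by move=> j /d0->; rewrite mul0r.
Qed.

(* If w is orthogonal to every unit vector, all its coordinates are equal to
   the sum of the coordinates, which is m times their common value. *)
Lemma weight_form_nondeg w : ~~ odd m -> w != 0 -> exists u, weight_form u w = 1.
Proof.
move=> m_even w0.
have [/existsP[i /eqP wi]|] := boolP [exists i, weight_form (delta_mx i 0) w == 1].
  by exists (delta_mx i 0).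
rewrite negb_exists => /forallP w_orth; case/eqP: w0.
have wE i : w i 0 = \sum_j w j 0.
  have := w_orth i; rewrite weight_form_delta -F2_neq0 negbK addr_eq0 => /eqP->.
  by case: (F2_0or1 (w i 0)) => ->; apply/eqP.
have s0 : \sum_j w j 0 = 0.
  under eq_bigr => j _ do rewrite wE.
  by rewrite sumr_const card_ord -mulr_natr F2_natr_odd (negbTE m_even) mulr0.
by apply/colP=> i; rewrite mxE wE.
Qed.

Definition weight_ind (s : seq nat) w : 'F_2 := ((wt w^T %% 4)%N \in s)%:R.

Lemma wt_sum n (x : 'rV['F_2]_n) : wt x = (\sum_i (x 0 i != 0)%R)%N.
Proof.
by rewrite /wt -sum1_card big_mkcond; apply: eq_bigr => i _; rewrite inE; case: (_ == _).
Qed.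

Definition overlap u v : 'rV['F_2]_m := \row_i (u i 0 * v i 0).

Lemma wtD_overlap u v :
  (wt (u + v)%R^T + wt (overlap u v) * 2 = wt u^T + wt v^T)%N.
Proof.
rewrite !wt_sum big_distrl -!big_split /=; apply: eq_bigr => i _; rewrite !mxE.
by case: (F2_0or1 (u i 0)) (F2_0or1 (v i 0)) => -> [] ->.
Qed.

Lemma wtD_mod4 u v :
  (wt (u + v)%R^T %% 4 =
   (wt u^T %% 4 + wt v^T %% 4 + odd (wt (overlap u v)) * 2) %% 4)%N.
Proof.
have := wtD_overlap u v; set k := wt (overlap u v) => uvk.
(* Modulo 4, subtracting twice the overlap amounts to adding twice its parity. *)
have k4 : (k * 2 + odd k * 2 = (odd k + k./2) * 4)%N.
  by rewrite -{1}(odd_double_half k) -muln2 !mulnDl addnAC -mulnDr -mulnA.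
by rewrite -modnDml modnDm modnDml -uvk -addnA k4 addnC modnMDl.
Qed.

(** The form depends only on the two weights modulo 4 and the parity of the overlap, the data that
    also determine the weight of [u + v] modulo 4. *)
Lemma weight_form_wt u v :
  weight_form u v =
  (odd (wt u^T %% 4)%N && odd (wt v^T %% 4)%N (+) odd (wt (overlap u v)))%:R.
Proof.
have sE w : \sum_i w i 0 = (odd (wt w^T %% 4)%N)%:R.
  rewrite odd_mod // -F2_natr_odd wt_natr.
  by apply: eq_bigr => i _; rewrite mxE.
rewrite /weight_form !sE.
have -> : \sum_i u i 0 * v i 0 = (odd (wt (overlap u v)))%:R.
  by rewrite -F2_natr_odd wt_natr; apply: eq_bigr => i _; rewrite mxE.
by apply/eqP; do 3!case: (odd _).
Qed.

(* Here a and b are the weights modulo 4 of two vectors and k is the parity of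
   the number of their common ones. *)
Definition polar_check (s : seq nat) (e c : 'F_2) : bool :=
  all (fun a => all (fun b => all (fun k : bool =>
    (((a + b + k * 2) %% 4)%N \in s)%:R ==
    (a \in s)%:R + (b \in s)%:R + e * (odd a && odd b (+) k)%:R + c)
  [:: true; false]) (iota 0 4)) (iota 0 4).

(** Both sides depend on two residues modulo 4 and one parity, so the identity is a check of 32
    cases. *)
Lemma weight_ind_polar s e c u v : polar_check s e c ->
  weight_ind s (u + v) =
    weight_ind s u + weight_ind s v + e * weight_form u v + c.
Proof.
move=> /allP sP; rewrite weight_form_wt /weight_ind wtD_mod4; apply/eqP.
have lt4 w : (wt w^T %% 4)%N \in iota 0 4 by rewrite mem_iota ltn_mod.
have /allP/(_ _ (lt4 v))/allP := sP _ (lt4 u).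
by apply; case: (odd _).
Qed.

End WeightModFour.

(** * Counts and sums over nonzero vectors, and the codes with a polarised appended row *)

Section SimplexColumns.

Local Open Scope ring_scope.

Variables (m n : nat) (H : 'M['F_2]_(m, n)).

Hypothesis m_gt2 : (2 < m)%N.
Hypothesis m_even : ~~ odd m.
Hypothesis col_inj : injective (fun j => col j H).
Hypothesis col_neq0 : forall j, col j H != 0.
Hypothesis col_onto : forall w, w != 0 -> exists j, col j H = w.

Lemma col_range : [set col j H | j : 'I_n] = [set u | u != 0].
Proof.
apply/setP=> u; rewrite inE; apply/imsetP/idP=> [[j _ ->]|/col_onto[j <-]].
  exact: col_neq0.
by exists j.
Qed.

Lemma sum_col (F : 'cV['F_2]_m -> 'F_2) :
  \sum_j F (col j H) = \sum_(u | u != 0) F u.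
Proof.
transitivity (\sum_(u in [set col j H | j : 'I_n]) F u).
  by rewrite big_imset //=; apply: in2W.
by rewrite col_range; apply: eq_bigl => u; rewrite inE.
Qed.

Lemma card_col_pred (P : pred 'cV['F_2]_m) :
  #|[set j | P (col j H)]| = #|[set u | (u != 0) && P u]|.
Proof.
rewrite -(card_imset _ col_inj); apply: eq_card => u; rewrite inE.
apply/imsetP/andP=> [[j]|[u0 Pu]]; first by rewrite inE => Pj ->.
by have [j ju] := col_onto u0; exists j; rewrite ?inE ju.
Qed.

Lemma card_cV2 : #|{: 'cV['F_2]_m}| = (2 ^ m)%N.
Proof. by rewrite card_mx card_Fp // muln1. Qed.

Lemma card_columns : n = (2 ^ m - 1)%N.
Proof.
have := card_col_pred predT; rewrite -card_cV2 subn1 -(cardC1 (0 : 'cV['F_2]_m)).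
have -> : [set j : 'I_n | predT (col j H)] = setT by apply/setP=> j; rewrite !inE.
by rewrite cardsT card_ord => ->; apply: eq_card => u; rewrite !inE andbT.
Qed.

(** Translation by a vector not orthogonal to [w] exchanges the two fibres, which together have 2 ^
    m elements. *)
Lemma card_form_eq (w : 'cV['F_2]_m) (b : 'F_2) : w != 0 ->
  #|[set u | weight_form w u == b]| = (2 ^ m.-1)%N.
Proof.
move=> w0; have [a aw] := weight_form_nondeg m_even w0.
have E : #|[set u | weight_form w u == 0]| = #|[set u | weight_form w u == 1]|.
  rewrite -(card_imset _ (addrI a)); apply: eq_card => u; rewrite inE.
  apply/imsetP/idP=> [[v]|wu1].
    rewrite !inE => /eqP wv ->.
    by rewrite weight_form_sym weight_formDl aw weight_form_sym wv.
  exists (a + u); last by rewrite addrA F2_mx_addrr add0r.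
  by rewrite inE weight_form_sym weight_formDl aw weight_form_sym (eqP wu1).
have D : (#|[set u | weight_form w u == 0%R]|
    + #|[set u | weight_form w u == 1%R]| = 2 ^ m)%N.
  rewrite -card_cV2 -(cardsC [set u | weight_form w u == 0]); congr addn.
  by apply: eq_card => u; rewrite !inE F2_neq0.
apply/eqP; rewrite -(eqn_pmul2r (isT : (0 < 2)%N)) -expnSr prednK ?(leq_trans _ m_gt2) //.
by rewrite -D muln2 -addnn; case: (F2_0or1 b) => ->; rewrite E.
Qed.

(** Since a_i = 1, each coset of {0, a} has exactly one member with i-th coordinate 0. *)
Lemma sum_pairs (F : 'cV['F_2]_m -> 'F_2) (a : 'cV['F_2]_m) i : a i 0 = 1 ->
  \sum_u F u = \sum_(u : 'cV['F_2]_m | u i 0 == 0) (F u + F (u + a)).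
Proof.
move=> ai; rewrite (bigID (fun u : 'cV['F_2]_m => u i 0 == 0)).
rewrite big_split /=; congr (_ + _).
rewrite (reindex_inj (addIr a)) /=; apply: eq_bigl => u.
by rewrite mxE ai; case: (F2_0or1 (u i 0)) => ->.
Qed.

Lemma sum_invariant (F : 'cV['F_2]_m -> 'F_2) (a : 'cV['F_2]_m) :
  a != 0 -> (forall u, F (u + a) = F u) -> \sum_u F u = 0.
Proof.
move=> a0 Fa; have [i ai] : exists i, a i 0 = 1.
  have [/existsP[i /eqP ai]|] := boolP [exists i, a i 0 == 1]; first by exists i.
  rewrite negb_exists => /forallP z; case/eqP: a0; apply/colP=> i.
  by have := z i; rewrite -F2_neq0 negbK mxE => /eqP.
by rewrite (sum_pairs F ai) big1 // => u _; rewrite Fa F2_addrr.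
Qed.

Variables (f : 'cV['F_2]_m -> 'F_2) (e c : 'F_2).
Hypothesis f_polar : forall u v, f (u + v) = f u + f v + e * weight_form u v + c.

Let C := parity_check_code (col_mx H (\row_j f (col j H))).

Let i0 : 'I_m := Ordinal (ltn_trans (isT : (0 < 2)%N) m_gt2).
Let i1 : 'I_m := Ordinal (ltn_trans (isT : (1 < 2)%N) m_gt2).
Let i2 : 'I_m := Ordinal m_gt2.

Let delta_sum (i : 'I_m) : \sum_j (delta_mx i 0 : 'cV['F_2]_m) j 0 = 1.
Proof.
rewrite (bigD1 i) //= mxE !eqxx big1 ?addr0 // => j ij.
by rewrite mxE (negbTE ij).
Qed.

Lemma f_at0 : f 0 = c.
Proof.
have := f_polar 0 0; rewrite weight_form_alt mulr0 !addr0 F2_addrr.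
by rewrite add0r.
Qed.

(** Pairing u with u + e_0 leaves the derivative of [f], summed over u_0 = 0. Adding e_1 + e_2,
    which lies in this hyperplane and is orthogonal to e_0, preserves the derivative, so its values
    cancel in pairs. Three coordinates require m > 2. *)
Lemma sum_polar : \sum_u f u = 0.
Proof.
have d1 : (delta_mx i0 0 : 'cV['F_2]_m) i0 0 = 1 by rewrite mxE !eqxx.
rewrite (sum_pairs f d1) big_mkcond /=.
(* The derivative of f along the first unit vector is invariant under b. *)
pose b : 'cV['F_2]_m := delta_mx i1 0 + delta_mx i2 0.
apply: (sum_invariant (a := b)).
  by apply/eqP=> /colP/(_ i1); rewrite !mxE !eqxx.
move=> u; have b0 : b i0 0 = 0 by apply/eqP; rewrite /b !mxE.
have ub : (u + b) i0 0 = u i0 0 by rewrite mxE b0 addr0.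
rewrite ub; case: ifP => // _.
have pairE v : f v + f (v + delta_mx i0 0)
    = f (delta_mx i0 0) + e * weight_form v (delta_mx i0 0) + c.
  by rewrite f_polar !addrA F2_addrr add0r.
rewrite !pairE weight_formDl; congr (_ + e * _ + _).
suff -> : weight_form b (delta_mx i0 0) = 0 by rewrite addr0.
by apply/eqP; rewrite weight_formDl !weight_form_delta !delta_sum !mxE.
Qed.

Lemma mem_const1 : (const_mx 1 \in C) = (c == 0).
Proof.
rewrite mem_syndrome /syndrome -pair_eqE /=.
have -> : \sum_j (const_mx 1 : 'rV['F_2]_n) 0 j *: col j H = 0.
  apply/colP=> i; rewrite summxE [RHS]mxE.
  have -> : \sum_j ((const_mx 1 : 'rV['F_2]_n) 0 j *: col j H) i 0 = \sum_j col j H i 0.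
    by apply: eq_bigr => j _; rewrite !mxE mul1r.
  rewrite (sum_col (fun u => u i 0)).
  (* The i-th coordinate is unchanged by adding a unit vector e_k with k != i, so it sums to 0. *)
  have [k ki] : exists k : 'I_m, k != i.
    by have [->|i1i] := eqVneq i i0; [exists i1 | exists i0; rewrite eq_sym].
  have := @sum_invariant (fun u => u i 0) (delta_mx k 0).
  rewrite (bigD1 0) //= mxE add0r; apply.
    by apply/eqP=> /colP/(_ k); rewrite !mxE !eqxx.
  by move=> u; rewrite !mxE eq_sym (negbTE ki) addr0.
rewrite eqxx /=; under eq_bigr => j _ do rewrite mxE mul1r.
rewrite (sum_col f); have := sum_polar; rewrite (bigD1 0) //= f_at0 => /eqP.
by rewrite addrC addr_eq0 => /eqP->; rewrite oppr_eq0.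
Qed.

Lemma antipodal_polar : antipodal C <-> c = 0.
Proof.
split=> [/(_ 0 (mem0v C))|/eqP]; first by rewrite add0r mem_const1 => /eqP.
by rewrite -mem_const1 => C1 x xC; rewrite rpredD.
Qed.

(** The number of u outside {0, w} with e B(w, u) + c = 1, for (e, c) other than (0, 0). With n = 2
    ^ m - 1 the three values are (n + 1)/2, n - 1 and (n - 3)/2. *)
Definition defect_number : nat :=
  if c == 0 then (2 ^ m.-1)%N
  else if e == 0 then (2 ^ m - 2)%N else (2 ^ m.-1 - 2)%N.

Lemma defect_number_gt0 : (0 < defect_number)%N.
Proof.
have ltm : (1 < m.-1)%N by case: (m) m_gt2 => [|[|[|]]].
rewrite /defect_number; case: ifP => _; first by rewrite expn_gt0.
by case: ifP => _; rewrite subn_gt0 -{1}[2%N]expn1 ltn_exp2l // (leq_trans ltm) ?leq_pred.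
Qed.

(** For e = 0 the map f + c is linear, so the appended row contributes only [c] times the parity of
    the weight. *)
Lemma affine_syndrome x : e = 0 ->
  (syndrome H f x).2 = f (syndrome H f x).1 + c + c * (wt x)%:R.
Proof.
move=> e0; pose g u := f u + c.
have gD u v : g (u + v) = g u + g v.
  by rewrite /g f_polar e0 mul0r addr0 addrACA addrA.
have g0 : g 0 = 0 by rewrite /g f_at0 F2_addrr.
have -> : f (syndrome H f x).1 + c = \sum_j x 0 j * g (col j H).
  rewrite -/(g _) /= (big_morph g gD g0); apply: eq_bigr => j _.
  by case: (F2_0or1 (x 0 j)) => ->; rewrite ?scale0r ?scale1r ?mul0r ?mul1r.
rewrite wt_natr mulr_sumr -big_split; apply: eq_bigr => j _ /=.
by rewrite /g mulrDr -addrA [c * _]mulrC F2_addrr addr0.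
Qed.

Lemma mem_affine x : e = 0 ->
  (x \in C) = (x \in parity_check_code H) && (c * (wt x)%:R == 0).
Proof.
move=> e0; rewrite mem_syndrome (mem_hamming_syndrome H f).
have := affine_syndrome x e0; case: (syndrome H f x) => w t /= ->; rewrite -pair_eqE /=.
by case: eqP => //= ->; rewrite f_at0 F2_addrr add0r.
Qed.

Lemma affine_min_distance : e = 0 -> c = 1 -> min_distance C 4.
Proof.
move=> e0 c1.
have min_wt x : x \in C -> x != 0 -> (4 <= wt x)%N.
  move=> xC x0; have wx0 : wt x != 0%N by rewrite wt_eq0.
  have wx_even : ~~ odd (wt x).
    by move: xC; rewrite mem_affine // c1 mul1r F2_natr_eq0 => /andP[].
  (* Weight 2 would force two distinct positions to have equal columns. *)
  suff wx2 : wt x != 2 by case: (wt x) wx0 wx_even wx2 => [|[|[|[|]]]].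
  apply/eqP=> wx2; have /card_gt0P[j] : (0 < wt x)%N by rewrite wx2.
  rewrite inE => xj; have /eqP := wt_add_delta xj; rewrite wx2 eqSS => /wt_eq1P[i xi].
  have xE : x = delta_mx 0 i + delta_mx 0 j by rewrite -xi -addrA F2_mx_addrr addr0.
  move: xC x0; rewrite xE -{1}[delta_mx 0 j]F2_mx_opp syndrome_eq !syndrome_delta.
  by move=> /eqP[/col_inj-> _]; rewrite F2_mx_addrr eqxx.
split=> [x y xC yC xy|].
  by rewrite hdist_wt min_wt ?rpredB // subr_eq0.
pose d i : 'cV['F_2]_m := delta_mx i 0.
have d_neq0 i : d i != 0 by apply/eqP=> /colP/(_ i); rewrite !mxE !eqxx.
have d_neq i j : i != j -> d i != d j.
  by move=> ij; apply/eqP=> /colP/(_ i); rewrite !mxE !eqxx (negbTE ij).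
have s_neq0 : d i0 + d i1 + d i2 != 0.
  by apply/eqP=> /colP/(_ i0); rewrite !mxE !eqxx.
(* The columns at three unit vectors and at their sum add up to 0 and give a codeword of weight
   4. *)
have [a aE] := col_onto (d_neq0 i0); have [b bE] := col_onto (d_neq0 i1).
have [k kE] := col_onto (d_neq0 i2); have [l lE] := col_onto s_neq0.
pose x : 'rV['F_2]_n := delta_mx 0 a + delta_mx 0 b + delta_mx 0 k + delta_mx 0 l.
have xC : x \in C.
  rewrite mem_syndrome !syndromeD !syndrome_delta aE bE kE lE -pair_eqE /=.
  rewrite F2_mx_addrr eqxx /= !f_polar e0 !mul0r !addr0.
  by case: (F2_0or1 (f (d i0))) (F2_0or1 (f (d i1))) (F2_0or1 (f (d i2))) (F2_0or1 c)
    => -> [] -> [] -> [] ->.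
(* Position [a] differs from the other three, so x is nonzero; then [min_wt] gives weight at least
   4, and subadditivity at most 4. *)
have x0 : x != 0.
  have ne j : col j H != d i0 -> (a == j) = false.
    by rewrite -aE => ja; apply: contraNF ja => /eqP->.
  have ab : (a == b) = false by apply: ne; rewrite bE d_neq.
  have ak : (a == k) = false by apply: ne; rewrite kE d_neq.
  have al : (a == l) = false.
    apply: ne; rewrite lE -addrA -subr_eq0 addrAC subrr add0r.
    by rewrite -[d i2]F2_mx_opp subr_eq0 d_neq.
  by apply/eqP=> /rowP/(_ a); rewrite !mxE !eqxx ab ak al.
have wle (y : 'rV['F_2]_n) j q : (wt y <= q)%N -> (wt (y + delta_mx 0 j)%R <= q.+1)%N.
  by move=> yq; rewrite (leq_trans (wtD _ _)) // wt_delta addn1.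
have wx : wt x = 4%N.
  by apply/eqP; rewrite eqn_leq min_wt // andbT !wle ?wt_delta.
by exists x, 0; rewrite mem0v hdist_wt subr0.
Qed.

Hypothesis ec_neq0 : (e != 0) || (c != 0).

(** By [f_polar] the condition on u is e B(w, u) + c = 1. Both 0 and w are orthogonal to w, so they
    satisfy it, and must be discarded, exactly when c = 1. *)
Lemma card_defect (w : 'cV['F_2]_m) : w != 0 ->
  #|[set j | (col j H != w) && (f (w + col j H) != f w + f (col j H))]|
    = defect_number.
Proof.
move=> w0; rewrite (card_col_pred (fun u => (u != w) && (f (w + u) != f w + f u))).
have -> : [set u | [&& u != 0, u != w & f (w + u) != f w + f u]]
    = [set u | e * weight_form w u + c != 0] :\: [set 0; w].
  apply/setP=> u; rewrite !inE negb_or -andbA; congr [&& _, _ & _].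
  rewrite f_polar -addrA -subr_eq0 addrAC subrr add0r //.
have w0c : weight_form w 0 = 0.
  rewrite -[0 in LHS](F2_mx_addrr w).
  by rewrite weight_form_sym weight_formDl weight_form_alt addr0.
rewrite /defect_number cardsD; case: (F2_0or1 e) (F2_0or1 c) ec_neq0 => -> [] -> //= _.
- rewrite (_ : [set u | _] = setT); last first.
    by apply/setP=> u; rewrite !inE.
  by rewrite cardsT card_cV2 setTI cards2 eq_sym w0.
- rewrite (_ : [set u | _] = [set u | weight_form w u == 1]); last first.
    by apply/setP=> u; rewrite !inE mul1r addr0 F2_neq0.
  rewrite card_form_eq // (_ : _ :&: _ = set0) ?cards0 ?subn0 //.
  apply/setP=> u; rewrite !inE; apply/negP=> /andP[/eqP wu /orP[] /eqP uE].
    by move: wu; rewrite uE w0c.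
  by move: wu; rewrite uE weight_form_alt.
- rewrite (_ : [set u | _] = [set u | weight_form w u == 0]); last first.
    by apply/setP=> u; rewrite !inE mul1r; case: (F2_0or1 (weight_form w u)) => ->.
  rewrite card_form_eq // (_ : _ :&: _ = [set 0; w]); first by rewrite cards2 eq_sym w0.
  apply/setIidPr/subsetP=> u; rewrite !inE => /orP[] /eqP->.
    by rewrite w0c.
  by rewrite weight_form_alt.
Qed.

Let n_gt0 : (0 < n)%N.
Proof.
by rewrite card_columns subn_gt0 -{1}(expn0 2) ltn_exp2l // (leq_trans _ m_gt2).
Qed.

Lemma polar_completely_transitive : completely_transitive C.
Proof.
apply: (completely_transitive_syndrome n_gt0 col_inj col_neq0 col_onto
  defect_number_gt0 card_defect (@weight_formDl m) (@weight_form_sym m)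
  (@weight_form_alt m) _ f_polar).
by move=> w; apply: weight_form_nondeg.
Qed.

Lemma polar_covering_radius : covering_radius C = 3.
Proof.
exact: (covering_radius_syndrome n_gt0 col_inj col_neq0 col_onto
  defect_number_gt0 card_defect).
Qed.

Lemma polar_intersection_array :
  has_intersection_array C [:: n; defect_number; 1%N] [:: 1%N; defect_number; n].
Proof.
exact: (intersection_array_syndrome n_gt0 col_inj col_neq0 col_onto
  defect_number_gt0 card_defect).
Qed.

Lemma polar_dim : (\dim C + (m + 1) = n)%N.
Proof.
exact: (dim_syndrome_code n_gt0 col_inj col_neq0 col_onto
  defect_number_gt0 card_defect).
Qed.

End SimplexColumns.

(** * The columns of the Hamming matrix as coordinates of powers of [alpha] *)

Section HammingColumns.

Local Open Scope ring_scope.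

Variables (m : nat) (L : fieldExtType 'F_2) (alpha : L).
Hypothesis dimL : \dim {:L} = m.
Hypothesis alpha_prim : ((2 ^ m - 1)%N).-primitive_root alpha.

(** In a field of 2 ^ m elements [v] is a root of unity of order dividing 2 ^ m - 1, hence a power
    of the primitive root. *)
Lemma nonzero_is_power (v : L) : v != 0 -> {j : 'I_(2 ^ m - 1) | v = alpha ^+ j}.
Proof.
move=> v0; apply: (prim_rootP alpha_prim); apply: (mulfI v0).
have := Fermat's_little_theorem {:L}%AS v; rewrite memvf card_Fp // dimL.
move=> /esym/eqP; rewrite mulr1 -exprS subn1 prednK // expn_gt0 //.
Qed.

(** Each element is 0 or a power of [alpha], hence a polynomial in [alpha] of degree below m. So the
    m powers span a space of dimension m. *)
Lemma power_basis_basis : basis_of {:L} (power_basis alpha m).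
Proof.
rewrite basisEdim size_tuple dimL leqnn andbT; apply/subvP=> v _.
have vF : v \in <<1; alpha>>%VS.
  have [->|/nonzero_is_power[j ->]] := eqVneq v 0; first exact: mem0v.
  exact/rpredX/memv_adjoin.
have /polyOverP p1 := Fadjoin_polyOver 1%VS alpha v.
have ps : (size (Fadjoin_poly 1%VS alpha v) <= m)%N.
  apply: leq_trans (size_Fadjoin_poly _ _ _) _.
  by rewrite adjoin_degreeE dimv1 divn1 -dimL dimvS ?subvf.
rewrite -(Fadjoin_poly_eq vF) (horner_coef_wide _ ps); apply: memv_suml => i _.
have /vlineP[k ->] := p1 i; rewrite -scalerAl mul1r memvZ // memv_span //.
by apply/tnthP; exists i; rewrite tnth_mktuple.
Qed.

Let coords (v : L) : 'cV['F_2]_m := \col_i coord (power_basis alpha m) i v.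

Let coords_inj : injective coords.
Proof.
move=> u v /colP uv; rewrite (coord_basis power_basis_basis (memvf u)).
rewrite (coord_basis power_basis_basis (memvf v)); apply: eq_bigr => i _.
by have := uv i; rewrite !mxE => ->.
Qed.

Let col_hamming j : col j (hamming_mx alpha m) = coords (alpha ^+ j).
Proof. by apply/colP=> i; rewrite !mxE. Qed.

Let alpha_neq0 : alpha != 0.
Proof.
apply/eqP=> a0; have := prim_expr_order alpha_prim; rewrite a0 expr0n.
have /gtn_eqF-> := prim_order_gt0 alpha_prim.
by move/esym/eqP; rewrite oner_eq0.
Qed.

Lemma col_hamming_inj : injective (fun j => col j (hamming_mx alpha m)).
Proof.
move=> i j; rewrite !col_hamming => /coords_inj/eqP.
by rewrite (eq_prim_root_expr alpha_prim) !modn_small // => /eqP/val_inj.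
Qed.

Lemma col_hamming_neq0 j : col j (hamming_mx alpha m) != 0.
Proof.
have <- : coords 0 = 0 by apply/colP=> i; rewrite !mxE linear0.
by rewrite col_hamming (inj_eq coords_inj) expf_neq0.
Qed.

Lemma col_hamming_onto w : w != 0 -> exists j, col j (hamming_mx alpha m) = w.
Proof.
move=> w0; pose v : L := \sum_(i < m) w i 0 *: (power_basis alpha m)`_i.
have vw : coords v = w.
  by apply/colP=> i; rewrite mxE coord_sum_free // (basis_free power_basis_basis).
have [|j vj] := @nonzero_is_power v; last by exists j; rewrite col_hamming -vj.
apply: contra_neq w0 => v0; rewrite -vw v0.
by apply/colP=> i; rewrite !mxE linear0.
Qed.

Lemma weight_code_ind i1 i2 s : (i1 < 4)%N -> (i2 < 4)%N -> [:: i1; i2] =i s ->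
  weight_code alpha m i1 i2 =
  parity_check_code (col_mx (hamming_mx alpha m)
    (\row_j weight_ind s (col j (hamming_mx alpha m)))).
Proof.
move=> i1lt i2lt is_s; congr (parity_check_code (col_mx _ _)); apply/rowP=> j.
by rewrite !mxE /weight_ind -is_s !inE /= (modn_small i1lt) (modn_small i2lt).
Qed.

End HammingColumns.

Theorem theorem2p3 (m : nat) (L : fieldExtType 'F_2) (alpha : L)
    (i1 i2 : nat) :
  4 <= m -> ~~ odd m ->
  \dim {:L} = m -> ((2 ^ m - 1).-primitive_root alpha)%R ->
  i1 < 4 -> i2 < 4 -> i1 <> i2 ->
  let n := 2 ^ m - 1 in
  let C := weight_code alpha m i1 i2 in
  [/\ [:: i1; i2] =i [:: 0; 1] \/ [:: i1; i2] =i [:: 0; 3] ->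
        [/\ ~ antipodal C, completely_transitive C, covering_radius C = 3
          & has_intersection_array C [:: n; (n - 3) %/ 2; 1]
                                     [:: 1; (n - 3) %/ 2; n]],
      [:: i1; i2] =i [:: 1; 2] \/ [:: i1; i2] =i [:: 2; 3] ->
        [/\ antipodal C, completely_transitive C, covering_radius C = 3
          & has_intersection_array C [:: n; (n + 1) %/ 2; 1]
                                     [:: 1; (n + 1) %/ 2; n]],
      [:: i1; i2] =i [:: 0; 2] ->
        [/\ code_set C = even_weight_subcode (hamming_code alpha m),
            completely_transitive C, code_parameters C (n - m - 1) 4
          & covering_radius C = 3]
    & [:: i1; i2] =i [:: 1; 3] -> C = hamming_code alpha m].
Proof.
move=> m_ge4 m_even dimL alpha_prim i1lt i2lt _ n C.
have m_gt2 : 2 < m by apply: leq_trans m_ge4.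
have m_gt0 : 0 < m by apply: leq_trans m_ge4.
have cinj := col_hamming_inj dimL alpha_prim.
have cneq := col_hamming_neq0 dimL alpha_prim.
have conto := col_hamming_onto dimL alpha_prim.
have CE s : [:: i1; i2] =i s -> C = parity_check_code (col_mx (hamming_mx alpha m)
    (\row_j weight_ind s (col j (hamming_mx alpha m)))) by exact: weight_code_ind.
have fP s e c (sec : polar_check s e c) u v := @weight_ind_polar m s e c u v sec.
have half_p : (n + 1) %/ 2 = 2 ^ m.-1.
  by rewrite subnK ?expn_gt0 // -{1}(prednK m_gt0) expnS mulKn.
have half_m : (n - 3) %/ 2 = 2 ^ m.-1 - 2.
  by rewrite -subnDA -{1}(prednK m_gt0) expnS -(mulnBr 2 _ 2) mulKn.
(* Residues of opposite parity give e = 1; there c, the value of the indicator at 0, is 1 exactly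
   when residue 0 is selected. *)
have quad (s : seq nat) c : [:: i1; i2] =i s -> polar_check s 1%R c ->
    [/\ antipodal C <-> c = 0%R, completely_transitive C, covering_radius C = 3 &
      has_intersection_array C [:: n; defect_number m 1%R c; 1]
        [:: 1; defect_number m 1%R c; n]].
  move=> is_s /fP f_polar; rewrite (CE s is_s); split.
  - exact: (antipodal_polar m_gt2 cinj cneq conto f_polar).
  - exact: (polar_completely_transitive m_gt2 m_even cinj cneq conto f_polar).
  - exact: (polar_covering_radius m_gt2 m_even cinj cneq conto f_polar).
  - exact: (polar_intersection_array m_gt2 m_even cinj cneq conto f_polar).
split.
- move=> is_s.
  have [anti ctr rho arr] : [/\ antipodal C <-> (1 : 'F_2)%R = 0%R,
      completely_transitive C, covering_radius C = 3
      & has_intersection_array C [:: n; defect_number m 1%R 1%R; 1]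
        [:: 1; defect_number m 1%R 1%R; n]].
    by case: is_s => is_s; apply: quad is_s _.
  split=> //; first by move=> /anti/eqP; rewrite oner_eq0.
  by rewrite half_m.
- move=> is_s.
  have [anti ctr rho arr] : [/\ antipodal C <-> (0 : 'F_2)%R = 0%R,
      completely_transitive C, covering_radius C = 3
      & has_intersection_array C [:: n; defect_number m 1%R 0%R; 1]
        [:: 1; defect_number m 1%R 0%R; n]].
    by case: is_s => is_s; apply: quad is_s _.
  by split=> //; [apply/anti | rewrite half_p].
(* The indicator of even weights is affine with value 1 at 0, so e = 0 and c = 1. *)
- move=> is_s; have f_polar := @fP [:: 0; 2] 0%R 1%R isT.
  rewrite (CE _ is_s); split.
  + apply/setP=> x; rewrite !inE (mem_affine _ f_polar) //.
    by rewrite mul1r F2_natr_eq0.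
  + exact: (polar_completely_transitive m_gt2 m_even cinj cneq conto f_polar).
  + split; last exact: (affine_min_distance m_gt2 cinj conto f_polar).
    rewrite -subnDA; apply: (canRL (addnK (m + 1))).
    exact: (polar_dim m_gt2 m_even cinj cneq conto f_polar).
  + exact: (polar_covering_radius m_gt2 m_even cinj cneq conto f_polar).
(* The indicator of odd weights is linear, so e = c = 0 and the appended row imposes no new
   condition. *)
move=> is_s; have f_polar := @fP [:: 1; 3] 0%R 0%R isT.
rewrite (CE _ is_s); apply/vspaceP=> x.
by rewrite (mem_affine _ f_polar) // mul0r eqxx andbT.
Qed.
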